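(* For any Banach space $X$ with $\dim X\ge 2$, $$\frac{9}{2}\le G_L(X)\le 8.$$
   Context: For a Banach space $X$ with $\dim X\ge 2$, the constant $G_L(X)$ is defined by $$G_L(X)=\sup\{\|x+y\|^{2}+\|2x-y\|^{2}: x,y\in X,\ \|x\|=\|y\|=\|x-y\|=1\}.$$ *)

(* Defs.v *)
From HB Require Import structures.
From mathcomp Require Import all_boot all_order all_algebra.
From mathcomp Require Import boolp classical_sets reals ereal topology normedtype.

Set Implicit Arguments.
Unset Strict Implicit.
Unset Printing Implicit Defensive.

Import Order.TTheory GRing.Theory Num.Theory.
Import numFieldNormedType.Exports.

Local Open Scope classical_set_scope.
Local Open Scope ring_scope.

(* The dimension may be infinite, so "dim X >= n" is expressed by the existence
   of n linearly independent vectors. *)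
Definition dim_ge (R : realType) (n : nat) (X : lmodType R) : Prop :=
  exists e : 'I_n -> X,
    forall c : 'I_n -> R, \sum_(i < n) c i *: e i = 0 -> forall i, c i = 0.

(* The supremum is taken in the extended reals: it then needs no default value
   for empty or unbounded sets, unlike the real-valued [sup]. *)
Definition G_L (R : realType) (X : completeNormedModType R) : \bar R :=
  ereal_sup [set r : \bar R | exists x y : X,
    [/\ `|x| = 1, `|y| = 1, `|x - y| = 1
      & r = (`|x + y| ^+ 2 + `|2 *: x - y| ^+ 2)%:E]].

(* Main.v *)
Require Import Defs.
From HB Require Import structures.
From mathcomp Require Import all_boot all_order all_algebra.
From mathcomp Require Import boolp classical_sets reals ereal topology normedtype.
From mathcomp Require Import lra.

(** Both bounds come from the triangle inequality.  If [x], [y] and [x - y] are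
    unit vectors, then [x + y] and [2 *: x - y = x + (x - y)] are sums of two
    unit vectors, so their norms are at most 2 and the sum of the squares is at
    most 8.  These two sums add up to [3 *: x], so their norms [a] and
    [b] satisfy [3 <= a + b], whence [a ^ 2 + b ^ 2 >= (a + b) ^ 2 / 2 >= 9 / 2].
    Every admissible pair therefore gives a value in the interval from 9 / 2 to
    8, and the lower bound on the supremum only requires one admissible pair to
    exist ([exists_unit_equilateral]).  In dimension at least 2 the unit sphere
    contains a path from [- x] to [x], along which the distance to [x] goes
    continuously from 2 to 0 and hence takes the value 1. *)

Import Order.TTheory GRing.Theory Num.Theory.
Import numFieldNormedType.Exports.

Local Open Scope ring_scope.

Lemma dim_ge2_indep (R : realType) (X : lmodType R) : dim_ge 2 X ->
  exists u v : X, forall a b : R, a *: u + b *: v = 0 -> a = 0 /\ b = 0.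
Proof.
move=> [e indep]; exists (e ord0), (e ord_max) => a b ab0.
have /indep c0 : \sum_(i < 2) (if i == ord0 then a else b) *: e i = 0.
  rewrite big_ord_recl big_ord1 /= -[RHS]ab0; congr (_ + _ *: e _).
  exact: val_inj.
by split; [exact: (c0 ord0) | exact: (c0 ord_max)].
Qed.

Lemma norm_normalize (R : realType) (X : normedModType R) (v : X) :
  v != 0 -> `| `|v|^-1 *: v| = 1.
Proof. by move=> v0; rewrite normrZ normfV normr_id mulVf // normr_eq0. Qed.

(** For linearly independent [u] and [v], the parabola
    [t |-> t *: u + (1 - t ^+ 2) *: v] goes from [- u] to [u] without meeting
    the origin, so it can be projected radially onto the unit sphere. *)
Lemma exists_unit_equilateral (R : realType) (X : normedModType R) :
  dim_ge 2 X -> exists x y : X, [/\ `|x| = 1, `|y| = 1 & `|x - y| = 1].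
Proof.
move=> /dim_ge2_indep[u [v indep]].
pose p (t : R) : X := t *: u + (1 - t * t) *: v.
pose q t : X := `|p t|^-1 *: p t.
have p_neq0 t : p t != 0.
  apply/eqP => /indep[-> /eqP].
  by rewrite mulr0 subr0 oner_eq0.
have p1 : p 1 = u by rewrite /p mulr1 subrr scale0r addr0 scale1r.
have pN1 : p (-1) = - u by rewrite /p mulrNN mulr1 subrr scale0r addr0 scaleN1r.
have q_unit t : `|q t| = 1 by exact: norm_normalize.
have qN1 : q (-1) = - q 1 by rewrite /q p1 pN1 normrN scalerN.
have p_cont : continuous p.
  move=> t; apply: cvgD; apply: cvgZr_tmp; first exact: cvg_id.
  by apply: cvgB; [exact: cvg_cst | apply: cvgM; exact: cvg_id].
have q_cont : continuous q.
  move=> t; apply: cvgZ; last exact: p_cont.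
  apply: cvgV; first by rewrite normr_eq0.
  by apply: cvg_norm; exact: p_cont.
have f_cont : continuous (fun t => `|q 1 - q t|).
  move=> t; apply: cvg_norm; apply: cvgB; [exact: cvg_cst | exact: q_cont].
have fN1 : `|q 1 - q (-1)| = 2.
  by rewrite qN1 opprK -mulr2n normrMn q_unit.
have [|||t _ ft] := @IVT R (fun t => `|q 1 - q t|) (-1) 1 1.
- by lra.
- exact: continuous_subspaceT.
- by rewrite fN1 subrr normr0 ge_min ler01 orbT le_max ler1n.
by exists (q 1), (q t).
Qed.

Lemma equilateral_sum_sqr_le (R : realType) (X : normedModType R) (x y : X) :
  `|x| = 1 -> `|y| = 1 -> `|x - y| = 1 ->
  `|x + y| ^+ 2 + `|2 *: x - y| ^+ 2 <= 8.
Proof.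
move=> x1 y1 xy1.
have a2 : `|x + y| <= 2 by rewrite (le_trans (ler_normD _ _)) // x1 y1.
have b2 : `|2 *: x - y| <= 2.
  rewrite scaler_nat mulr2n -addrA.
  by rewrite (le_trans (ler_normD _ _)) // x1 xy1.
have := normr_ge0 (x + y); have := normr_ge0 (2 *: x - y); nra.
Qed.

Lemma norm1_sum_sqr_ge (R : realType) (X : normedModType R) (x y : X) :
  `|x| = 1 -> 9 / 2 <= `|x + y| ^+ 2 + `|2 *: x - y| ^+ 2.
Proof.
move=> x1.
have ab3 : 3 <= `|x + y| + `|2 *: x - y|.
  apply: le_trans (ler_normD _ _).
  have -> : (x + y) + (2 *: x - y) = 3 *: x.
    by rewrite addrC [x + y]addrC addrA addrNK !scaler_nat -mulrSr.
  by rewrite normrZ x1 mulr1 ger0_norm.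
(* [a ^+ 2 + b ^+ 2] is the mean of [(a + b) ^+ 2] and [(a - b) ^+ 2]. *)
have := sqr_ge0 (`|x + y| - `|2 *: x - y|); nra.
Qed.

Theorem theorem3p1 (R : realType) (X : completeNormedModType R)
    (hX : dim_ge 2 X) :
  ((9 / 2)%:E <= G_L X)%E /\ (G_L X <= 8%:E)%E.
Proof.
split.
- have [x [y [x1 y1 xy1]]] := @exists_unit_equilateral R X hX.
  apply: (@le_trans _ _ (`|x + y| ^+ 2 + `|2 *: x - y| ^+ 2)%:E).
    by rewrite lee_fin norm1_sum_sqr_ge.
  by apply: ereal_sup_ubound; exists x, y.
- apply: ge_ereal_sup => _ [x [y [x1 y1 xy1 ->]]].
  by rewrite lee_fin equilateral_sum_sqr_le.
Qed.
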